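(* For each $s\in\mathbb{N}$ there exist stiffly accurate A-stable peer two-step methods with $s$ stages and order $s-1$. That is, for each $s\ge1$ there exist pairwise distinct real nodes $c_1,\ldots,c_s$ and matrices $G,B\in\mathbb{R}^{s\times s}$ such that, with $E$ and $\Theta$ the differentiation and extrapolation matrices of these nodes, $B=(I-GE)\Theta$ and the method with coefficients $A=0,B,G$ is A-stable.
   Context: A peer two-step method with $s$ stages and constant stepsize $h$ for $y'=f(y)$, $f:\mathbb{R}^n\to\mathbb{R}^n$, is the recursion $Y_m-hGF_m=BY_{m-1}+hAF_{m-1}$, where $Y_m\in\mathbb{R}^{s\times n}$ has rows $Y_{mi}^{\sf T}$ with stages $Y_{mi}$ approximating $y(t_m+hc_i)$ for pairwise distinct nodes $c_1,\ldots,c_s\in\mathbb{R}$, $F_m\in\mathbb{R}^{s\times n}$ has rows $f(Y_{mi})^{\sf T}$, and $A,B,G\in\mathbb{R}^{s\times s}$ are the coefficient matrices ($G$ may be a full matrix). It is called stiffly accurate if $A=0$. Let $V=(c_i^{j-1})_{i,j=1}^s$ be the Vandermonde matrix and let $\tilde E\in\mathbb{R}^{s\times s}$ be the matrix with entries $\tilde E_{i,i+1}=i$ for $1\le i\le s-1$ and all other entries zero. Put $E:=V\tilde EV^{-1}$ (polynomial differentiation) and $\Theta:=e^{E}=Ve^{\tilde E}V^{-1}$ (polynomial extrapolation). A stiffly accurate peer method is said to have order $s-1$ (for constant stepsize) if $B=(I-GE)\Theta$. The stability matrix of a stiffly accurate method is $\mathbf{M}(z)=(I-zG)^{-1}B$.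 The method is called A-stable if $\varrho(\mathbf{M}(z))<1$ for all $z\in\mathbb{C}$ with $\Re z<0$, where $\varrho$ denotes the spectral radius. *)

(* Defs.v *)
From HB Require Import structures.
From mathcomp Require Import all_boot all_order all_algebra.
From mathcomp Require Import all_classical all_reals all_analysis.
From mathcomp Require Import complex.

Set Implicit Arguments.
Unset Strict Implicit.
Unset Printing Implicit Defensive.

Import Order.TTheory GRing.Theory Num.Theory.
Import numFieldNormedType.Exports.

Local Open Scope classical_set_scope.
Local Open Scope ring_scope.
Local Open Scope complex_scope.

Definition expmx (R : realType) (s : nat) (A : 'M[R]_s) : 'M[R]_s :=
  lim (series (fun k : nat => (k`!%:R)^-1 *: A ^+ k) @ \oo).

(* The set is finite, and nonempty when 0 < s, so the supremum is the maximum.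
   [eigenvalue] refers to row eigenvectors, which give the same spectrum. *)
Definition spectral_radius (R : realType) (s : nat) (M : 'M[R[i]]_s) : R :=
  sup [set Normc.normc l | l in [set l : R[i] | eigenvalue M l]].

(* Coefficients of Y_m - h G F_m = B Y_(m-1) + h A F_(m-1), where the rows of
   Y_m approximate y(t_m + h c_i) and F_m holds the values of f at these rows. *)
Record peer_method (R : realType) (s : nat) := PeerMethod {
  peer_c : 'rV[R]_s;
  peer_A : 'M[R]_s;
  peer_B : 'M[R]_s;
  peer_G : 'M[R]_s;
  peer_c_inj : injective (peer_c ord0)
}.

Definition stiffly_accurate (R : realType) (s : nat)
    (P : peer_method R s) : Prop :=
  peer_A P = 0.

(* The library's [Vandermonde] has the powers of each node in a column; here
   they are in a row: V i j = c_i ^+ j for 0-based i and j. *)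
Definition vander (R : realType) (s : nat) (c : 'rV[R]_s) : 'M[R]_s :=
  (Vandermonde s c)^T.

(* With 1-based indices, the entry at (i, i+1) is i. *)
Definition Etilde (R : realType) (s : nat) : 'M[R]_s :=
  \matrix_(i < s, j < s) (if j == i.+1 :> nat then i.+1%:R else 0).

Definition diff_mx (R : realType) (s : nat) (c : 'rV[R]_s) : 'M[R]_s :=
  vander c *m Etilde R s *m invmx (vander c).

Definition extrap_mx (R : realType) (s : nat) (c : 'rV[R]_s) : 'M[R]_s :=
  expmx (diff_mx c).

(* Order s - 1 for constant stepsize; meaningful for stiffly accurate methods. *)
Definition has_order_pred_s (R : realType) (s : nat)
    (P : peer_method R s) : Prop :=
  peer_B P =
    (1%:M - peer_G P *m diff_mx (peer_c P)) *m extrap_mx (peer_c P).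

Definition complexify (R : realType) (s : nat) (A : 'M[R]_s) : 'M[R[i]]_s :=
  map_mx (real_complex R) A.

(* The matrix I - z G whose inverse enters the stability matrix. *)
Definition stability_den (R : realType) (s : nat)
    (P : peer_method R s) (z : R[i]) : 'M[R[i]]_s :=
  1%:M - z *: complexify (peer_G P).

(* Stability matrix of a stiffly accurate method. *)
Definition stability_mx (R : realType) (s : nat)
    (P : peer_method R s) (z : R[i]) : 'M[R[i]]_s :=
  invmx (stability_den P z) *m complexify (peer_B P).

(* [invmx] returns its argument on singular matrices, so the existence of the
   stability matrix on the left half-plane is required explicitly. *)
Definition A_stable (R : realType) (s : nat) (P : peer_method R s) : Prop :=
  forall z : R[i], complex.Re z < 0 ->
    stability_den P z \in unitmx /\ spectral_radius (stability_mx P z) < 1.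

(* Main.v *)
Require Import Defs.
From mathcomp Require Import all_boot all_order all_algebra.
From mathcomp Require Import all_classical all_reals all_analysis.
From mathcomp Require Import complex.

(** Take G = I. Since E is nilpotent, B = (I - E) Θ = p(E) for a polynomial p
    with p(0) = 1, so B is unipotent. As I - z G = (1 - z) I, the only
    eigenvalue of M(z) is 1 / (1 - z), and |1 - z| >= Re (1 - z) > 1 on the open
    left half-plane. *)

Set Implicit Arguments.
Unset Strict Implicit.
Unset Printing Implicit Defensive.

Import Order.TTheory GRing.Theory Num.Theory.
Import numFieldNormedType.Exports.

Local Open Scope classical_set_scope.
Local Open Scope ring_scope.
Local Open Scope complex_scope.

(** Each further factor [A] moves the support one more superdiagonal up, so after [n.+1] factors no
    entry is left. *)
Lemma strictly_upper_nilpotent (R : nzRingType) (n : nat) (A : 'M[R]_n.+1) :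
  (forall i j : 'I_n.+1, (j <= i)%N -> A i j = 0) -> A ^+ n.+1 = 0.
Proof.
move=> A0.
have Ak k (i j : 'I_n.+1) : (j < i + k)%N -> (A ^+ k) i j = 0.
  elim: k i j => [|k IH] i j ltj.
    by rewrite addn0 in ltj; rewrite expr0 mxE; case: eqP ltj => // ->; rewrite ltnn.
  rewrite exprSr mxE big1 // => l _.
  (* In the sum over [l] of [(A ^+ k) i l * A l j], the left factor vanishes for [l < i + k];
     otherwise [j <= i + k <= l] and the right one does. *)
  have [lt_l|le_l] := ltnP l (i + k); first by rewrite IH ?mul0r.
  by rewrite A0 ?mulr0 // (leq_trans _ le_l) // -ltnS -addnS.
by apply/matrixP => i j; rewrite Ak ?mxE // ltn_addl.
Qed.

(** The partial sums are constant from index [k] on, so the limit is that constant. The polynomial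
    form turns later matrix identities into polynomial ones. *)
Lemma expmx_nilpotent (R : realType) (n k : nat) (A : 'M[R]_n.+1) :
  A ^+ k = 0 -> expmx A = horner_mx A (\poly_(i < k) (i`!%:R)^-1).
Proof.
move=> Ak0; apply: norm_lim_near_cst.
exists k => // m /= le_km.
rewrite poly_def rmorph_sum seriesEord /=.
rewrite (big_ord_widen _ (fun i => horner_mx A ((i`!%:R)^-1 *: 'X^i)) le_km).
rewrite [RHS]big_mkcond; apply: eq_bigr => i _.
rewrite linearZ rmorphXn /= horner_mx_X; case: ltnP => // le_ki.
by rewrite -(subnK le_ki) exprD Ak0 mulr0 scaler0.
Qed.

Lemma vander_unitmx (R : realType) (n : nat) (c : 'rV[R]_n) :
  injective (c ord0) -> vander c \in unitmx.
Proof.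
move=> c_inj; rewrite unitmxE det_tr det_Vandermonde unitfE.
apply/prodf_neq0 => i _; apply/prodf_neq0 => j lt_ij.
by rewrite subr_eq0; apply: contraTneq lt_ij => /c_inj->; rewrite ltnn.
Qed.

Lemma diff_mx_nilpotent (R : realType) (n : nat) (c : 'rV[R]_n.+1) :
  injective (c ord0) -> diff_mx c ^+ n.+1 = 0.
Proof.
move=> /vander_unitmx Vu.
have Et0 : Etilde R n.+1 ^+ n.+1 = 0.
  apply: strictly_upper_nilpotent => i j le_ji; rewrite mxE.
  by case: eqP => // ji; rewrite ji ltnn in le_ji.
have Ek k : diff_mx c ^+ k = vander c *m (Etilde R n.+1 ^+ k) *m invmx (vander c).
  elim: k => [|k IH]; first by rewrite !expr0 mulmx1 mulmxV.
  by rewrite !exprS IH -!mulmxE /diff_mx !mulmxA mulmxKV.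
by rewrite Ek Et0 mulmx0 mul0mx.
Qed.

(** The matrix is [q(E)] with [q = (1 - 'X) * p - 1], where [p] is the truncated exponential. Since
    [p(0) = 1], ['X] divides [q], hence ['X^n.+1] divides [q ^+ n.+1]. *)
Lemma order_mx_unipotent (R : realType) (n : nat) (E : 'M[R]_n.+1) :
  E ^+ n.+1 = 0 -> ((1 - E) * expmx E - 1) ^+ n.+1 = 0.
Proof.
move=> E0; rewrite (expmx_nilpotent E0).
set p := \poly_(i < _) _; pose q := (1 - 'X) * p - 1.
have -> : (1 - E) * horner_mx E p - 1 = horner_mx E q.
  by rewrite /q rmorphB rmorphM rmorphB !rmorph1 /= horner_mx_X.
have /factor_theorem[r ->] : root q 0.
  rewrite rootE /q !hornerE subr0 mul1r horner_coef0 coef_poly /= fact0.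
  by rewrite invr1 subrr.
by rewrite polyC0 subr0 -rmorphXn exprMn rmorphM !rmorphXn /= horner_mx_X E0 mulr0.
Qed.

(** On an eigenvector [v], the nilpotent [A - 1] acts as the scalar [l - 1], which must then be
    nilpotent in a field. *)
Lemma eigenvalue_unipotent (F : fieldType) (n k : nat) (A : 'M[F]_n.+1) (l : F) :
  (A - 1) ^+ k = 0 -> eigenvalue A l -> l = 1.
Proof.
move=> A0 /eigenvalueP[v vA v_neq0].
have vk : v *m (A - 1) ^+ k = (l - 1) ^+ k *: v.
  elim: k {A0} => [|k IH]; first by rewrite !expr0 mulmx1 scale1r.
  rewrite exprS -mulmxE mulmxA mulmxBr vA mulmx1 -{2}[v]scale1r -scalerBl.
  by rewrite -scalemxAl IH scalerA -exprS.
move: vk; rewrite A0 mulmx0 => /esym/eqP.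
by rewrite scaler_eq0 (negPf v_neq0) orbF expf_eq0 subr_eq0 => /andP[_ /eqP].
Qed.

Lemma eigenvalueZ (F : fieldType) (n : nat) (A : 'M[F]_n) (a l : F) :
  a != 0 -> eigenvalue (a *: A) l -> eigenvalue A (a^-1 * l).
Proof.
move=> a0 /eigenvalueP[v vA v0]; apply/eigenvalueP; exists v => //.
by rewrite -scalerA -vA -scalemxAr scalerA mulVf // scale1r.
Qed.

Lemma spectral_radius_le (R : realType) (n : nat) (M : 'M[R[i]]_n) (r : R) :
  0 <= r -> (forall l, eigenvalue M l -> Normc.normc l <= r) ->
  spectral_radius M <= r.
Proof.
move=> r0 Mr; rewrite /spectral_radius.
set S := [set _ | _ in _].
(* The supremum of the empty set is 0 by convention; this case uses [0 <= r]. *)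
have [->|/set0P S0] := eqVneq S set0; first by rewrite sup0.
by apply: ge_sup => // _ [l Ml <-]; exact: Mr.
Qed.

Lemma Re_le_normc (R : rcfType) (x : R[i]) : complex.Re x <= Normc.normc x.
Proof.
case: x => a b /=; apply: le_trans (ler_norm a) _.
by rewrite -sqrtr_sqr ler_wsqrtr // lerDl sqr_ge0.
Qed.

Theorem theorem3p7 (R : realType) (s : nat) (hs : (0 < s)%N) :
  exists P : peer_method R s,
    stiffly_accurate P /\ has_order_pred_s P /\ A_stable P.
Proof.
case: s hs => // n _.
(* Any pairwise distinct nodes would do; 0, 1, ..., n are a convenient choice. *)
pose c : 'rV[R]_n.+1 := \row_(i < n.+1) (i : nat)%:R.
have c_inj : injective (c ord0).
  by move=> i j; rewrite !mxE => /eqP; rewrite eqr_nat => /eqP/val_inj.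
pose B := (1%:M - diff_mx c) *m extrap_mx c.
exists (PeerMethod 0 B 1%:M c_inj); split=> //; split.
  by rewrite /has_order_pred_s /= mul1mx.
move=> z z_lt0; rewrite /stability_mx.
have -> : stability_den (PeerMethod 0 B 1%:M c_inj) z = (1 - z)%:M.
  by rewrite /stability_den /complexify /= map_mx1 scalemx1 -raddfB.
have norm_gt1 : 1 < Normc.normc (1 - z).
  by apply: lt_le_trans (Re_le_normc _); case: z z_lt0 => a b /= a0; rewrite ltrDl oppr_gt0.
have z_neq1 : 1 - z != 0.
  by apply: contraTneq norm_gt1 => ->; rewrite Normc.normc0 ltr10.
split; first by rewrite unitmxE det_scalar unitrX // unitfE.
rewrite invmx_scalar mul_scalar_mx /=.
have inv_lt1 : (Normc.normc (1 - z))^-1 < 1 by rewrite invf_lt1 // (lt_trans ltr01).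
apply: le_lt_trans inv_lt1; apply: spectral_radius_le => [|l].
  by rewrite invr_ge0 (le_trans ler01) // ltW.
(* An eigenvalue [l] of the stability matrix gives the eigenvalue [(1 - z) * l] of [B], which
   unipotency forces to be 1. *)
move=> /eigenvalueZ; rewrite invr_eq0 invrK => /(_ z_neq1) Bl.
have B1 : (complexify B - 1) ^+ n.+1 = 0.
  have -> : complexify B - 1 = map_mx (real_complex R) (B - 1).
    by rewrite map_mxB map_mx1.
  rewrite -rmorphXn /= [X in map_mx _ X]order_mx_unipotent ?map_mx0 //.
  exact: diff_mx_nilpotent.
have l1 := eigenvalue_unipotent B1 Bl.
by rewrite -Normc.normcV -(mulKf z_neq1 l) l1 mulr1.
Qed.
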